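(* Let $Y\subseteq\ell_1^n$ be a real subspace of the complex $\ell_1^n$ space. Suppose that $y_0\in Y$ is a unique best approximation in $Y$ for a real vector $x\in\ell_1^n\setminus Y$ (i.e. $x\in\mathbb{R}^n$). Then $y_0$ is a real vector and it is a $1$-strongly unique best approximation for $x$ in $Y$.
   Context: The complex space $\ell_1^n$ is $\mathbb{C}^n$ with norm $\|x\|_1=|x_1|+\dots+|x_n|$; $n\ge2$, and ''subspace'' means a proper nonzero linear subspace. A linear subspace of $\mathbb{C}^n$ is a real subspace if it has a basis (over $\mathbb{C}$) consisting of vectors in $\mathbb{R}^n$. A vector $y_0\in Y$ is a best approximation for $x$ in $Y$ if $\|x-y\|\ge\|x-y_0\|$ for all $y\in Y$; it is unique if no other element of $Y$ has this property. It is a $1$-strongly unique best approximation for $x$ in $Y$ if there is $r>0$ with $\|x-y\|\ge\|x-y_0\|+r\|y-y_0\|$ for all $y\in Y$. *)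

(* Defs.v *)
From mathcomp Require Import all_boot all_order all_algebra.
From mathcomp Require Import reals complex.

Set Implicit Arguments.
Unset Strict Implicit.
Unset Printing Implicit Defensive.

Import Order.TTheory GRing.Theory Num.Theory.
Local Open Scope ring_scope.

(* [Normc.normc z] is the modulus of [z : R[i]] as an element of [R];
   the generic norm [`|z|] is the same number seen in [R[i]]. *)
Definition l1norm (R : realType) (n : nat) (x : 'rV[R[i]]_n) : R :=
  \sum_(j < n) Normc.normc (x 0 j).

(* In [R[i]], [Num.real] is the set of numbers with zero imaginary part. *)
Definition real_vector (R : realType) (n : nat) (x : 'rV[R[i]]_n) : Prop :=
  x \is a mxOver Num.real.

Definition real_subspace (R : realType) (n : nat)
    (Y : {vspace 'rV[R[i]]_n}) : Prop :=
  exists2 b : seq 'rV[R[i]]_n,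
    basis_of Y b & forall v, v \in b -> real_vector v.

Definition best_approximation (R : realType) (n : nat)
    (Y : {vspace 'rV[R[i]]_n}) (x y0 : 'rV[R[i]]_n) : Prop :=
  y0 \in Y /\ forall y, y \in Y -> l1norm (x - y0) <= l1norm (x - y).

Definition unique_best_approximation (R : realType) (n : nat)
    (Y : {vspace 'rV[R[i]]_n}) (x y0 : 'rV[R[i]]_n) : Prop :=
  best_approximation Y x y0 /\
  forall y, best_approximation Y x y -> y = y0.

Definition strongly_unique1_best_approximation (R : realType) (n : nat)
    (Y : {vspace 'rV[R[i]]_n}) (x y0 : 'rV[R[i]]_n) : Prop :=
  y0 \in Y /\
  exists2 r : R, 0 < r &
    forall y, y \in Y ->
      l1norm (x - y0) + r * l1norm (y - y0) <= l1norm (x - y).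

(* Main.v *)
Require Import Defs.
From HB Require Import structures.
From mathcomp Require Import all_boot all_order all_algebra.
From mathcomp Require Import reals complex.
From mathcomp Require Import boolp classical_sets topology normedtype derive.
From mathcomp Require Import ring lra.

Set Implicit Arguments.
Unset Strict Implicit.
Unset Printing Implicit Defensive.

Import Order.TTheory GRing.Theory Num.Theory.
Local Open Scope ring_scope.

(** Since x and Y are invariant under complex conjugation, so is the unique
    best approximation y0, which is therefore real. Put z = x - y0. For real w,
    |z - t w|_1 = |z|_1 + t g(w) for small t > 0, where
    g(w) = sum_(z_j = 0) |w_j| - sum_j sgn(z_j) w_j.
    Uniqueness makes g positive on the nonzero real vectors of Y, hence, by
    compactness, g(w) >= r |w|_1 there. For y = u + i v in Y,
    |z - y|_1 - |z|_1 >= G(y) := sum_(z_j = 0) |y_j| - sum_j sgn(z_j) u_j, and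
    G(y) >= g(u) >= r |u|_1, while adding g(v) and g(-v) gives
    sum_(z_j = 0) |v_j| >= r |v|_1, so that G(y) >= r |v|_1 - |u|_1. *)

Definition complexify (R : realType) n (w : 'rV[R]_n) : 'rV[R[i]]_n :=
  map_mx (real_complex R) w.

Definition real_part (R : realType) n (y : 'rV[R[i]]_n) : 'rV[R]_n :=
  map_mx (@complex.Re R) y.

Definition imag_part (R : realType) n (y : 'rV[R[i]]_n) : 'rV[R]_n :=
  map_mx (@complex.Im R) y.

Definition real_l1norm (R : realType) n (w : 'rV[R]_n) : R :=
  \sum_j `|w 0 j|.

(* The one-sided derivative at t = 0 of the l1 norm of z - t w. *)
Definition l1_slope (R : realType) n (z w : 'rV[R]_n) : R :=
  \sum_(j | z 0 j == 0) `|w 0 j| - \sum_j Num.sg (z 0 j) * w 0 j.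

(** * The complex modulus against real and imaginary parts *)

Section Modulus.
Variable R : realType.
Implicit Types (a : R) (c : R[i]).

Lemma normc_real a : Normc.normc (real_complex R a) = `|a|.
Proof. by rewrite /= expr0n /= addr0 sqrtr_sqr. Qed.

Lemma normc_conjc c : Normc.normc (conjc c) = Normc.normc c.
Proof. by case: c => a b /=; rewrite sqrrN. Qed.

Lemma normr_Re_le c : `|complex.Re c| <= Normc.normc c.
Proof. by case: c => a b /=; rewrite -sqrtr_sqr ler_wsqrtr // lerDl sqr_ge0. Qed.

Lemma normr_Im_le c : `|complex.Im c| <= Normc.normc c.
Proof. by case: c => a b /=; rewrite -sqrtr_sqr ler_wsqrtr // lerDr sqr_ge0. Qed.

Lemma normc_le_ReIm c :
  Normc.normc c <= `|complex.Re c| + `|complex.Im c|.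
Proof.
case: c => a b /=.
rewrite -[leRHS]ger0_norm ?addr_ge0 // -sqrtr_sqr ler_wsqrtr //.
rewrite sqrrD !real_normK ?num_real //.
have : 0 <= `|a| * `|b| by rewrite mulr_ge0.
lra.
Qed.

End Modulus.

(** * Real and imaginary parts of vectors, and first-order estimates of the norm *)

Section RealVectors.
Variables (R : realType) (n : nat).
Implicit Types (w z : 'rV[R]_n) (y : 'rV[R[i]]_n).

Lemma complexifyB z w : complexify (z - w) = complexify z - complexify w.
Proof. exact: map_mxB. Qed.

Lemma l1norm_complexify w : l1norm (complexify w) = real_l1norm w.
Proof. by apply: eq_bigr => j _; rewrite mxE normc_real. Qed.

Lemma l1norm_conjc y : l1norm (map_mx conjc y) = l1norm y.
Proof. by apply: eq_bigr => j _; rewrite mxE normc_conjc. Qed.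

Lemma complexify_real_part y : real_vector y -> complexify (real_part y) = y.
Proof.
move=> /mxOverP yr; apply/rowP => j; rewrite !mxE.
by rewrite RRe_real.
Qed.

Lemma real_vector_conjc y : real_vector y <-> map_mx conjc y = y.
Proof.
split=> [yr|yE].
  rewrite -(complexify_real_part yr); apply/rowP => j.
  by rewrite !mxE conjc_real.
apply/mxOverP => i j; have /(congr1 (fun A : 'rV_n => A i j)) := yE.
rewrite mxE; case: (y i j) => a b /= [bN].
by rewrite complex_real; apply/eqP; lra.
Qed.

(** Here and in the next lemma the parts are written as combinations of [y] and its conjugate, so a
    conjugation-invariant subspace contains them with [y]. *)
Lemma complexify_real_partE y :
  complexify (real_part y) = 2^-1 *: (y + map_mx conjc y).
Proof.
by apply/rowP => j; rewrite !mxE ReJ_add mulrC.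
Qed.

Lemma complexify_imag_partE y :
  complexify (imag_part y) = ('i%C / 2) *: (map_mx conjc y - y).
Proof.
by apply/rowP => j; rewrite !mxE ImJ_sub; ring.
Qed.

Lemma real_l1norm_ge0 w : 0 <= real_l1norm w.
Proof. exact: sumr_ge0. Qed.

Lemma real_l1norm_eq0 w : real_l1norm w = 0 -> w = 0.
Proof.
move=> /eqP; rewrite psumr_eq0 // => /allP w0; apply/rowP => j.
by rewrite mxE; apply/eqP; rewrite -normr_eq0; apply: w0; rewrite mem_index_enum.
Qed.

Lemma real_l1normZ t w : real_l1norm (t *: w) = `|t| * real_l1norm w.
Proof. by rewrite mulr_sumr; apply: eq_bigr => j _; rewrite mxE normrM. Qed.

Lemma l1_slopeZ z w t : 0 <= t -> l1_slope z (t *: w) = t * l1_slope z w.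
Proof.
move=> t0; rewrite mulrBr !mulr_sumr; congr (_ - _); apply: eq_bigr => j _.
  by rewrite mxE normrM ger0_norm.
by rewrite mxE mulrCA.
Qed.

Lemma l1norm_le_parts y :
  l1norm y <= real_l1norm (real_part y) + real_l1norm (imag_part y).
Proof.
by rewrite -big_split; apply: ler_sum => j _; rewrite !mxE normc_le_ReIm.
Qed.

Lemma sum_sgM_le z w : \sum_j Num.sg (z 0 j) * w 0 j <= real_l1norm w.
Proof.
apply: ler_sum => j _; apply: le_trans (ler_norm _) _.
by rewrite normrM normr_sg ler_piMl //; case: (_ != _).
Qed.

Lemma l1_slopeDN z w :
  l1_slope z w + l1_slope z (- w) = 2 * \sum_(j | z 0 j == 0) `|w 0 j|.
Proof.
rewrite /l1_slope.
under [X in _ + (X - _)]eq_bigr do rewrite mxE normrN.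
under [X in _ + (_ - X)]eq_bigr do rewrite mxE mulrN.
by rewrite sumrN; ring.
Qed.

(* The radius is [(1 + \sum_k |w_k| / |z_k|)^-1], where the junk value
   [a / 0 = 0] discards the indices with [z_k = 0]. *)
Lemma exists_small_step z w :
  exists2 t, 0 < t & forall j, z 0 j != 0 -> t * `|w 0 j| <= `|z 0 j|.
Proof.
pose s := 1 + \sum_k `|w 0 k| / `|z 0 k|.
have s_gt0 : 0 < s.
  by rewrite ltr_wpDr // sumr_ge0 // => k _; rewrite divr_ge0.
exists s^-1 => [|j zj]; first by rewrite invr_gt0.
rewrite ler_pdivrMl // -ler_pdivrMr ?normr_gt0 // /s (bigD1 j) //=.
rewrite addrCA lerDl addr_ge0 // sumr_ge0 // => k _.
by rewrite divr_ge0.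
Qed.

(** For such small [t] no nonzero coordinate of [z] changes sign, so the norm is affine along the
    step and the expansion is exact. *)
Lemma real_l1norm_step z w :
  exists2 t, 0 < t &
    real_l1norm (z - t *: w) = real_l1norm z + t * l1_slope z w.
Proof.
have [t t_gt0 tle] := exists_small_step z w; exists t => //.
rewrite /l1_slope mulrBr !mulr_sumr big_mkcond /= -sumrB -big_split /=.
apply: eq_bigr => j _; rewrite !mxE.
have [->|zj] := eqVneq (z 0 j) 0.
  by rewrite sgr0 sub0r normrN normrM gtr0_norm // normr0; ring.
have /ler_normlP[lo hi] : `|t * w 0 j| <= `|z 0 j|.
  by rewrite normrM gtr0_norm //; exact: tle.
move: zj; rewrite neq_lt => /orP[zj|zj].
  rewrite ltr0_sg // (ltr0_norm zj) in lo hi *.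
  by rewrite ler0_norm; lra.
rewrite gtr0_sg // (gtr0_norm zj) in lo hi *.
by rewrite ger0_norm; lra.
Qed.

(** Coordinatewise: equality where [z 0 j] vanishes; elsewhere the modulus dominates the real part,
    which is at least its product with the sign of [z 0 j]. *)
Lemma l1norm_sub_ge z y :
  real_l1norm z + (\sum_(j | z 0 j == 0) Normc.normc (y 0 j)
    - \sum_j Num.sg (z 0 j) * real_part y 0 j) <= l1norm (complexify z - y).
Proof.
rewrite big_mkcond /= -sumrB -big_split /=; apply: ler_sum => j _.
rewrite !mxE; have [->|zj] := eqVneq (z 0 j) 0.
  by rewrite sgr0 mul0r subr0 normr0 add0r sub0r normcN.
apply: le_trans (normr_Re_le _).
case: (y 0 j) => a b /=; rewrite sub0r normrEsg -mulrBr.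
by rewrite (le_trans (ler_norm _)) // normrM normr_sg zj mul1r.
Qed.

Lemma strong_uniqueness_of_slope (z : 'rV[R]_n) y (r : R) :
    0 < r ->
    (forall w, w \in [:: real_part y; imag_part y; - imag_part y] ->
       r * real_l1norm w <= l1_slope z w) ->
  real_l1norm z + r ^+ 2 / (2 * (1 + r)) * l1norm y <= l1norm (complexify z - y).
Proof.
move=> r_gt0 slope_ge; apply: le_trans (l1norm_sub_ge z y); rewrite lerD2l.
set G := (X in _ <= X).
set U := real_l1norm (real_part y); set V := real_l1norm (imag_part y).
have slopeU : r * U <= l1_slope z (real_part y).
  by apply: slope_ge; rewrite inE eqxx.
have slopeV : r * V <= l1_slope z (imag_part y).
  by apply: slope_ge; rewrite !inE eqxx orbT.
have slopeVN : r * V <= l1_slope z (- imag_part y).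
  rewrite (_ : V = real_l1norm (- imag_part y)).
    by apply: slope_ge; rewrite !inE eqxx !orbT.
  by apply: eq_bigr => j _; rewrite [in RHS]mxE normrN.
have GU : r * U <= G.
  apply: le_trans slopeU _; rewrite lerD2r; apply: ler_sum => j _.
  by rewrite mxE normr_Re_le.
(* The sign sum is at most [U]. On the zeros of [z] the modulus dominates the imaginary part, whose
   sum is the mean of the slopes at [imag_part y] and its opposite. *)
have GV : r * V - U <= G.
  apply: lerB; last exact: sum_sgM_le.
  apply: (@le_trans _ _ (\sum_(j | z 0 j == 0) `|imag_part y 0 j|)).
    by have := l1_slopeDN z (imag_part y); lra.
  by apply: ler_sum => j _; rewrite mxE normr_Im_le.
have U_ge0 : 0 <= U := real_l1norm_ge0 _.
have y_le : l1norm y <= U + V := l1norm_le_parts y.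
rewrite mulrAC ler_pdivrMr; last by rewrite mulr_gt0 // addr_gt0.
apply: (@le_trans _ _ (r ^+ 2 * (U + V))).
  by rewrite ler_wpM2l // sqr_ge0.
(* Adding [1 + r] times [GU] and [r] times [GV] gives [r ^+ 2 * (U + V) <= (1 + 2 * r) * G]; since
   [G] is nonnegative, the factor may grow to [2 * (1 + r)]. *)
nra.
Qed.

End RealVectors.

(** * From pointwise positivity to a uniform lower bound *)

Section Compactness.
Import numFieldNormedType.Exports.
Local Open Scope classical_set_scope.
Variables (R : realType) (n : nat).
Implicit Types w : 'rV[R]_n.

Lemma sum_continuous (T : topologicalType) (I : Type) (s : seq I) (P : pred I)
    (F : I -> T -> R) :
  (forall i, continuous (F i)) -> continuous (fun x => \sum_(i <- s | P i) F i x).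
Proof.
move=> cF x; elim: s => [|i s IHs].
  by under eq_fun do rewrite big_nil; exact: cvg_cst.
under eq_fun do rewrite big_cons.
case: (P i); last exact: IHs.
by apply: cvgD; [exact: cF | exact: IHs].
Qed.

(** A linear form is a finite combination of coordinates. *)
Lemma scalar_continuous (f : 'rV[R]_n -> R) : scalar f -> continuous f.
Proof.
move=> f_lin.
pose fL : {scalar 'rV[R]_n} := HB.pack f (GRing.isLinear.Build _ _ _ _ f f_lin).
have -> : f = fun w => \sum_i w 0 i * f (delta_mx 0 i).
  apply/funext => w; rewrite -[f]/(fL : _ -> _) {1}[w]row_sum_delta linear_sum.
  by apply: eq_bigr => i _; rewrite linearZ.
apply: sum_continuous => i w.
by apply: continuousM; [exact: coord_continuous | exact: cst_continuous].
Qed.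

Lemma real_l1norm_continuous : continuous (@real_l1norm R n).
Proof.
apply: sum_continuous => i w.
by apply: continuous_comp; [exact: coord_continuous | exact: norm_continuous].
Qed.

Lemma l1_slope_continuous (z : 'rV[R]_n) : continuous (l1_slope z).
Proof.
move=> w; apply: continuousB; apply: sum_continuous => i {}w.
  by apply: continuous_comp; [exact: coord_continuous | exact: norm_continuous].
apply: (@continuousM _ _ (fun=> Num.sg (z 0 i)) (fun v : 'rV[R]_n => v 0 i)).
  exact: cst_continuous.
exact: coord_continuous.
Qed.

(** The set is the common zero set of finitely many real linear forms: the real and imaginary parts
    of the coordinates of [p]. *)
Lemma closed_complexify (Y : {vspace 'rV[R[i]]_n}) :
  closed [set w : 'rV[R]_n | complexify w \in Y].
Proof.
(* The residual of the projection onto [Y] vanishes exactly on [Y]; it is linear over [R] through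
   the embedding into [R[i]]. *)
have [p pE p_lin] : exists2 p : 'rV[R]_n -> 'rV[R[i]]_n,
    forall w, complexify w \in Y <-> p w = 0 &
    forall a u w, p (a *: u + w) = real_complex R a *: p u + p w.
  exists (fun w => complexify w - projv Y (complexify w)) => [w|a u w].
    split=> [/projv_id ->|/subr0_eq ->]; [exact: subrr | exact: memv_proj].
  have -> : complexify (a *: u + w) =
      real_complex R a *: complexify u + complexify w.
    by rewrite /complexify map_mxD map_mxZ.
  by rewrite linearP scalerBr opprD addrACA.
have -> : [set w | complexify w \in Y] =
    \bigcap_j ([set w | complex.Re (p w 0 j) = 0]
               `&` [set w | complex.Im (p w 0 j) = 0]).
  apply/seteqP; split=> w /= => [/pE pw0 j _|pw0].
    by rewrite /= pw0 mxE.
  apply/pE/rowP => j; rewrite mxE; apply/eqP; rewrite eq_complex.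
  by have [/= -> ->] := pw0 j I; rewrite !eqxx.
apply: closed_bigI => j _; apply: closedI.
- apply: (@preimage_closed _ _ (fun w => complex.Re (p w 0 j)) [set 0]).
    move=> v _; apply: scalar_continuous => a u w.
    rewrite p_lin !mxE; case: (p u 0 j) (p w 0 j) => [b c] [d e] /=.
    by rewrite mul0r subr0.
  exact: closed_eq.
- apply: (@preimage_closed _ _ (fun w => complex.Im (p w 0 j)) [set 0]).
    move=> v _; apply: scalar_continuous => a u w.
    rewrite p_lin !mxE; case: (p u 0 j) (p w 0 j) => [b c] [d e] /=.
    by rewrite mul0r addr0.
  exact: closed_eq.
Qed.

(** The minimum of [g] over the compact set of unit vectors of the cone is positive, and homogeneity
    carries the bound to all of [C]. *)
Lemma homogeneous_coercive (g : 'rV[R]_n -> R) (C : set 'rV[R]_n) :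
    closed C -> (forall t w, 0 <= t -> C w -> C (t *: w)) ->
    continuous g -> (forall t w, 0 <= t -> g (t *: w) = t * g w) ->
    (forall w, C w -> w != 0 -> 0 < g w) ->
  exists2 r, 0 < r & forall w, C w -> r * real_l1norm w <= g w.
Proof.
move=> C_closed C_cone g_cont g_hom g_pos.
pose A := [set w | real_l1norm w = 1] `&` C.
have A_compact : compact A.
  apply: bounded_closed_compact.
    exists 1; split; first exact: num_real.
    move=> M M_gt1 w [w1 _]; apply: ltW; apply: le_lt_trans M_gt1.
    (* The ambient norm is the maximum norm, which the l1 norm dominates. *)
    rewrite [leLHS]/Num.norm /= mx_normrE; apply/bigmax_leP; split=> //= -[i j] _.
    by rewrite ord1 -w1 /real_l1norm (bigD1 j) //= lerDl sumr_ge0.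
  apply: closedI => //.
  apply: (@preimage_closed _ _ (@real_l1norm R n) [set 1]); last exact: closed_eq.
  by move=> w _; exact: real_l1norm_continuous.
have [r r_gt0 gA] : exists2 r, 0 < r & forall w, A w -> r <= g w.
  have [A0|/set0P/negP/negPn/eqP A0] := pselect (A !=set0).
    have [c /set_mem[c1 Cc] c_min] :=
      EVT_min_rV A0 A_compact (continuous_subspaceT g_cont).
    exists (g c) => [|w Aw]; last by apply: c_min; rewrite inE.
    apply: g_pos => //; apply: contra_eq_neq c1 => ->.
    by rewrite -(scale0r 0) real_l1normZ normr0 mul0r eq_sym oner_eq0.
  (* If the cone has no unit vector, any positive constant serves. *)
  by exists 1 => // w; rewrite A0.
exists r => // w Cw.
have [->|w_neq0] := eqVneq w 0.
  by rewrite -(scale0r 0) real_l1normZ g_hom // normr0 !mul0r mulr0.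
have w_gt0 : 0 < real_l1norm w.
  rewrite lt0r real_l1norm_ge0 andbT; apply: contraNneq w_neq0.
  by move=> /real_l1norm_eq0 ->.
have := gA ((real_l1norm w)^-1 *: w); rewrite g_hom; last by rewrite invr_ge0 ltW.
rewrite ler_pdivlMl // mulrC; apply; split=> /=.
  by rewrite real_l1normZ gtr0_norm ?invr_gt0 // mulVf // gt_eqF.
by apply: C_cone => //; rewrite invr_ge0 ltW.
Qed.

End Compactness.

(** * Conjugation invariance and consequences of uniqueness *)

Section RealSubspace.
Variables (R : realType) (n : nat) (Y : {vspace 'rV[R[i]]_n}).
Hypothesis Y_real : real_subspace Y.

(** Conjugation fixes the vectors of a real basis and only conjugates the coefficients. *)
Lemma real_subspace_conjc y : y \in Y -> map_mx conjc y \in Y.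
Proof.
have [b /andP[/eqP bY _] b_real] := Y_real.
rewrite -{1}bY => /(@coord_span _ _ _ (in_tuple b)) ->.
rewrite map_mx_sum memv_suml // => i _; rewrite map_mxZ memvZ //.
have bi : b`_i \in b by rewrite mem_nth.
have /real_vector_conjc -> := b_real _ bi.
by rewrite -bY memv_span.
Qed.

Lemma real_subspace_parts y : y \in Y ->
  complexify (real_part y) \in Y /\ complexify (imag_part y) \in Y.
Proof.
move=> yY; have cyY := real_subspace_conjc yY.
rewrite complexify_real_partE complexify_imag_partE.
by split; apply: memvZ; [exact: memvD | exact: memvB].
Qed.

Lemma unique_best_approximation_real x y0 :
  real_vector x -> unique_best_approximation Y x y0 -> real_vector y0.
Proof.
move=> x_real [[y0Y y0_best] y0_unique]; apply/real_vector_conjc/y0_unique.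
split=> [|y yY]; first exact: real_subspace_conjc.
apply: le_trans (y0_best y yY).
have /real_vector_conjc {1}<- := x_real.
by rewrite -map_mxB l1norm_conjc.
Qed.

Lemma unique_best_approximation_slope_gt0 x y0 (z w : 'rV[R]_n) :
    unique_best_approximation Y x y0 -> x - y0 = complexify z ->
    complexify w \in Y -> w != 0 ->
  0 < l1_slope z w.
Proof.
move=> [[y0Y y0_best] y0_unique] xy0 wY; apply: contra_neqT; rewrite -leNgt.
move=> slope_le0; have [t t_gt0 stepE] := real_l1norm_step z w.
have twY : complexify (t *: w) \in Y by rewrite /complexify map_mxZ memvZ.
(* With a nonpositive slope the small step does not increase the distance to [x], so uniqueness
   forces the step to be zero. *)
have /y0_unique/eqP : best_approximation Y x (y0 + complexify (t *: w)).
  split=> [|y yY]; first exact: memvD.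
  apply: le_trans (y0_best y yY).
  rewrite opprD addrA xy0 -complexifyB !l1norm_complexify stepE gerDl.
  by rewrite pmulr_rle0.
rewrite addrC -subr_eq0 addrK => /eqP tw0; apply/rowP => j.
have /(congr1 (fun A : 'rV_n => A 0 j)) := tw0.
rewrite !mxE => /complexI/eqP.
by rewrite mulf_eq0 gt_eqF // => /eqP.
Qed.

End RealSubspace.

Theorem theorem4p7 (R : realType) (n : nat) (n_ge2 : (2 <= n)%N)
    (Y : {vspace 'rV[R[i]]_n}) (Y_neq0 : Y != 0%VS) (Y_proper : Y != fullv)
    (Y_real : real_subspace Y)
    (x : 'rV[R[i]]_n) (x_real : real_vector x) (x_notin_Y : x \notin Y)
    (y0 : 'rV[R[i]]_n) (y0_unique : unique_best_approximation Y x y0) :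
  real_vector y0 /\ strongly_unique1_best_approximation Y x y0.
Proof.
have y0_real := unique_best_approximation_real Y_real x_real y0_unique.
split=> //; have [[y0Y _] _] := y0_unique; split=> //.
pose z := real_part (x - y0).
have zE : x - y0 = complexify z.
  rewrite complexify_real_part //; apply/real_vector_conjc.
  by rewrite map_mxB (proj1 (real_vector_conjc _) x_real)
    (proj1 (real_vector_conjc _) y0_real).
have [r r_gt0 slope_ge] : exists2 r : R, 0 < r &
    forall w, complexify w \in Y -> r * real_l1norm w <= l1_slope z w.
  apply: (homogeneous_coercive (@closed_complexify R n Y)).
  - by move=> t w _ /= wY; rewrite /complexify map_mxZ memvZ.
  - exact: l1_slope_continuous.
  - by move=> t w; exact: l1_slopeZ.
  - by move=> w /= wY; exact: unique_best_approximation_slope_gt0 y0_unique zE wY.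
exists (r ^+ 2 / (2 * (1 + r))).
  by rewrite divr_gt0 ?exprn_gt0 ?mulr_gt0 ?addr_gt0.
move=> y yY; rewrite zE l1norm_complexify.
(* Recentring at [y0] leaves the increment [y - y0], an element of [Y] whose real and imaginary
   parts lie in [Y] too. *)
have -> : x - y = complexify z - (y - y0) by rewrite -zE opprB addrA subrK.
apply: strong_uniqueness_of_slope => // w; rewrite !inE => w_in.
have [uY vY] := real_subspace_parts Y_real (memvB yY y0Y).
apply: slope_ge; case/or3P: w_in => /eqP -> //.
by rewrite /complexify map_mxN memvN.
Qed.
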